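(* Let $\{e_n\}_{n\in\mathbb{Z}}$ be i.i.d. real random variables with $\mathbb{E}|e_1|^2<\infty$, let $q,d\ge1$, $r,\mu_1,\mu_2,\phi_i,\psi_i\in\mathbb{R}$, and with $a_n=\mu_2+e_n+\sum_{i=1}^q\psi_ie_{n-i}$, $b_n=\mu_1+e_n+\sum_{i=1}^q\phi_ie_{n-i}$ assume $\mathbb{P}(a_n\le r,\ b_n\le r)+\mathbb{P}(a_n>r,\ b_n>r)\neq 0$. Let $\{y_n\}_{n\in\mathbb{Z}}$ be the unique strictly stationary solution of $$y_n=\begin{cases}\mu_1+e_n+\sum_{i=1}^q\phi_ie_{n-i}, & \text{if } y_{n-d}\le r,\\ \mu_2+e_n+\sum_{i=1}^q\psi_ie_{n-i}, & \text{if } y_{n-d}>r.\end{cases}$$ Then $\mathbb{E}y_0^2<\infty$ and there exist constants $C>0$ and $\rho\in(0,1)$ such that $|\operatorname{Cov}(y_0,y_k)|\le C\rho^k$ for all $k\ge1$; in particular, when $\operatorname{Var}(y_0)>0$, the autocorrelation function $\rho_k=\operatorname{Cov}(y_0,y_k)/\operatorname{Var}(y_0)$ satisfies $\rho_k=O(\rho^k)$ as $k\to\infty$.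
   Context: A solution means a process on the same probability space as $\{e_n\}$ satisfying the equation almost surely for every $n$; under the stated hypothesis such a strictly stationary, ergodic solution exists and is unique. *)

(* Defs.v *)
From HB Require Import structures.
From mathcomp Require Import all_boot all_order all_algebra.
From mathcomp Require Import all_classical all_reals all_analysis.
Set Implicit Arguments. Unset Strict Implicit. Unset Printing Implicit Defensive.
Import Order.TTheory GRing.Theory Num.Theory.
Local Open Scope classical_set_scope.
Local Open Scope ring_scope.

Section Defs.
Context {dT : measure_display} {T : measurableType dT} {R : realType}.
Variable P : probability T R.

Definition mutually_independent (X : int -> T -> R) : Prop :=
  forall (s : seq int) (B : int -> set R), uniq s ->
    (forall i, measurable (B i)) ->
    P (\big[setI/setT]_(i <- s) (X i @^-1` B i)) =
    (\prod_(i <- s) P (X i @^-1` B i))%E.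

Definition identically_distributed (X : int -> T -> R) : Prop :=
  forall (n m : int) (A : set R), measurable A ->
    P (X n @^-1` A) = P (X m @^-1` A).

Definition iid (X : int -> T -> R) : Prop :=
  mutually_independent X /\ identically_distributed X.

(* Strict stationarity: every finite-dimensional distribution is invariant
   under time shifts (laws determined on measurable rectangles). *)
Definition strictly_stationary (Y : int -> T -> R) : Prop :=
  forall (s : seq int) (B : int -> set R) (h : int),
    (forall i, measurable (B i)) ->
    P (\big[setI/setT]_(i <- s) (Y i @^-1` B i)) =
    P (\big[setI/setT]_(i <- s) (Y (i + h) @^-1` B i)).

End Defs.

(* Main.v *)
(** Write B_n and A_n for the two moving averages driving the regimes and call
  the time n a coupling time if A_n and B_n lie on the same side of r. At a
  coupling time the regime chosen at n + d does not depend on the past, so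
  running the recursion for m steps from an arbitrary initial regime gives y_n
  exactly, unless none of n - d, ..., n - m d is a coupling time. Among the
  times n - s L with L = (q + 1) d these events are independent, because each
  one involves only q + 1 consecutive noises; they have a common probability
  > 0 by shift invariance of the law of the noise. Hence the m-step truncation
  of y_n, with m = (q + 1) M, is within O(beta^(M/2)) of y_n in L^2, for some
  beta < 1. For M about k / L the truncation of y_k is a function of the noises
  after time 0, and so is uncorrelated with the truncation of y_0. *)
Require Import Defs.
From HB Require Import structures.
From mathcomp Require Import all_boot all_order all_algebra zify ring lra.
From mathcomp Require Import all_classical all_reals all_analysis.
From mathcomp Require Import measurable_realfun.
Import Order.TTheory GRing.Theory Num.Theory.
Local Open Scope classical_set_scope.
Local Open Scope ring_scope.

(** * Independence *)

Section pi_systems.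
Context {d : measure_display} {T : measurableType d} {R : realType}.

Lemma probability_eq_g_sigma_algebra (P Q : probability T R) (G : set (set T)) :
  G `<=` measurable -> setI_closed G -> G setT ->
  (forall A, G A -> P A = Q A) -> forall A, <<s G >> A -> P A = Q A.
Proof.
move=> Gm GI GT PQ; apply: (g_sigma_algebra_measure_unique G Gm (fun=> setT)) => //.
- by rewrite bigcup_const.
- by move=> k; rewrite /= probability_setT ltry.
Qed.

(** For fixed [B] both sides are finite measures in [A]: the restriction of [P] to [B], and [P]
    scaled by [P B]. Agreement on a pi-system containing [setT] extends to the sigma-algebra it
    generates. *)
Lemma indep_g_sigma_algebral (P : probability T R) (G : set (set T)) (B : set T) :
  G `<=` measurable -> setI_closed G -> G setT -> measurable B ->
  (forall A, G A -> P (A `&` B) = P A * P B)%E ->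
  forall A, <<s G >> A -> (P (A `&` B) = P A * P B)%E.
Proof.
move=> Gm GI GT mB PAB A GA.
have PB0 : 0 <= fine (P B) by rewrite fine_ge0.
have PBE : (fine (P B))%:E = P B by rewrite fineK// fin_num_measure.
suff -> : P (A `&` B) = mscale (NngNum PB0) P A.
  by rewrite /mscale /= PBE muleC.
apply: (g_sigma_algebra_measure_unique G Gm (fun=> setT) _ _ (mrestr P mB)) => //.
- by rewrite bigcup_const.
- by move=> C GC; rewrite /= /mrestr /mscale /= PAB// PBE muleC.
- by move=> k; rewrite /= /mrestr setTI ltey_eq fin_num_measure.
Qed.

Lemma indep_g_sigma_algebra (P : probability T R) (G H : set (set T)) :
  G `<=` measurable -> setI_closed G -> G setT ->
  H `<=` measurable -> setI_closed H -> H setT ->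
  (forall A B, G A -> H B -> P (A `&` B) = P A * P B)%E ->
  forall A B, <<s G >> A -> <<s H >> B -> (P (A `&` B) = P A * P B)%E.
Proof.
move=> Gm GI GT Hm HI HT PAB A B GA HB.
have sub K : K `<=` measurable -> <<s K >> `<=` @measurable _ T.
  by move=> Km; apply: smallest_sub => //; exact: sigma_algebra_measurable.
have mA : measurable A by exact: sub GA.
rewrite setIC muleC; apply: (indep_g_sigma_algebral P H) => // C HC.
rewrite setIC muleC; apply: (indep_g_sigma_algebral P G) => //; first exact: Hm.
by move=> D GD; exact: PAB.
Qed.

End pi_systems.

(** * Expectation and covariance of two independent variables *)

Section independent_pairs.
Local Open Scope ereal_scope.
Context {d : measure_display} {T : measurableType d} {R : realType}.
Variables (P : probability T R) (X Y : {RV P >-> R}).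
Hypothesis indepXY : forall A B : set R, measurable A -> measurable B ->
  P (X @^-1` A `&` Y @^-1` B) = P (X @^-1` A) * P (Y @^-1` B).

Let XY w : R * R := (X w, Y w).

Let measurable_XY : measurable_fun [set: T] XY.
Proof. exact: measurable_fun_pair. Qed.

HB.instance Definition _ := isMeasurableFun.Build _ _ _ _ XY measurable_XY.

(** This is where independence enters: the product law is determined by its values on rectangles,
    and there the joint law factors. *)
Let distribution_pair (A : set (R * R)) : measurable A ->
  (distribution P X \x distribution P Y) A = distribution P XY A.
Proof. exact: product_measure_unique. Qed.

Lemma indep_ge0_expectationM :
  (forall w, 0 <= X w)%R -> (forall w, 0 <= Y w)%R ->
  'E_P[X \* Y] = 'E_P[X] * 'E_P[Y].
Proof.
move=> X0 Y0.
(* Tonelli needs nonnegativity on the whole plane, whereas [X] and [Y] are nonnegative only at their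
   values; the norm repairs this and changes nothing along the pair. *)
pose f (z : R * R) : R := `|z.1 * z.2|%R.
have mf : measurable_fun [set: R * R] (EFin \o f).
  apply/measurable_EFinP; apply: measurableT_comp => //.
  exact: measurable_funM.
pose g (x : R) : R := `|x|%R.
have mabs : measurable_fun [set: R] (EFin \o g).
  by apply/measurable_EFinP; exact: measurableT_comp.
have f0 z : 0 <= (f z)%:E by rewrite lee_fin /f normr_ge0.
have g0 x : 0 <= (g x)%:E by rewrite lee_fin /g normr_ge0.
have EX (Z : {RV P >-> R}) : (forall w, 0 <= Z w)%R ->
    \int[distribution P Z]_x (g x)%:E = 'E_P[Z].
  move=> Z0; rewrite ge0_integral_distribution//.
  rewrite expectation_def.
  by apply: eq_integral => w _ /=; rewrite /g ger0_norm.
transitivity (\int[distribution P X \x distribution P Y]_z (f z)%:E).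
  rewrite unlock [RHS](eq_measure_integral (distribution P XY)); last first.
    by move=> A mA _; exact: distribution_pair.
  rewrite ge0_integral_distribution//.
  apply: eq_integral => w _ /=; rewrite /f /XY ger0_norm//=.
  by rewrite mulr_ge0.
rewrite fubini_tonelli1//.
transitivity (\int[distribution P X]_x ((g x)%:E * 'E_P[Y])).
  apply: eq_integral => x _; rewrite -[in RHS]EX//= -ge0_integralZl//.
  by apply: eq_integral => y _; rewrite /f/= normrM EFinM.
by rewrite ge0_integralZr ?EX ?expectation_ge0.
Qed.

Lemma indep_covariance0 :
  (X : T -> R) \in Lfun P 2%:E -> (Y : T -> R) \in Lfun P 2%:E ->
  covariance P X Y = 0.
Proof.
move=> X2 Y2.
have Pfin : P setT \is a fin_num := fin_num_measure P _ measurableT.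
have X1 := Lfun_subset12 Pfin X2; have Y1 := Lfun_subset12 Pfin Y2.
have XY1 := Lfun2_mul_Lfun1 X2 Y2.
rewrite covarianceE//.
suff -> : 'E_P[X * Y] = 'E_P[X] * 'E_P[Y].
  by rewrite subee// fin_numM ?expectation_fin_num.
pose m (z : R * R) : R := (z.1 * z.2)%R.
have mf : measurable_fun [set: R * R] (EFin \o m).
  by apply/measurable_EFinP; exact: measurable_funM.
have mid : measurable_fun [set: R] (EFin \o @idfun R)
  by apply/measurable_EFinP; exact: measurable_id.
have iZ (Z : {RV P >-> R}) : (Z : T -> R) \in Lfun P 1 ->
    (distribution P Z).-integrable setT (EFin \o @idfun R).
  move=> /Lfun1_integrable iZ; exact: integrable_pushforward.
have EX (Z : {RV P >-> R}) : (Z : T -> R) \in Lfun P 1 ->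
    \int[distribution P Z]_x x%:E = 'E_P[Z].
  by move=> /Lfun1_integrable iZ1; rewrite integral_distribution// unlock.
transitivity (\int[distribution P X \x distribution P Y]_z (m z)%:E).
  rewrite unlock [RHS](eq_measure_integral (distribution P XY)); last first.
    by move=> A mA _; exact: distribution_pair.
  rewrite integral_distribution//.
  exact/Lfun1_integrable.
(* Fubini needs integrability under the product law. This is the law of the pair, so integrability
   of [X * Y] suffices. *)
rewrite -integral12_prod_meas1//; last first.
  apply/integrableP; split=> //.
  rewrite (eq_measure_integral (distribution P XY)); last first.
    by move=> A mA _; exact: distribution_pair.
  rewrite ge0_integral_distribution//; last exact: measurableT_comp.
  by move/Lfun1_integrable/integrableP : XY1 => [].
transitivity (\int[distribution P X]_x (x%:E * 'E_P[Y])).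
  apply: eq_integral => x _; rewrite -[in RHS]EX//= -integralZl//; exact: iZ.
rewrite -[in LHS](@fineK _ 'E_P[Y]) ?expectation_fin_num//.
by rewrite integralZr ?EX ?fineK ?expectation_fin_num//; exact: iZ.
Qed.

End independent_pairs.

(** * Second moments *)

Section square_integrable.
Local Open Scope ereal_scope.
Context {d : measure_display} {T : measurableType d} {R : realType}.
Variable P : probability T R.

Lemma expectation_sqr_Lfun2 (f : T -> R) : measurable_fun setT f ->
  'E_P[fun w => (f w ^+ 2)%R] < +oo -> f \in Lfun P 2%:E.
Proof.
move=> mf; rewrite unlock => foo.
rewrite inE/=; apply/andP; split; rewrite inE//= /finite_norm unlock poweR_lty//.
apply: le_lt_trans foo.
by under eq_integral => w _ do rewrite /= powR_mulrn// real_normK ?num_real//.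
Qed.

Lemma Lfun2_expectation_sqr (f : T -> R) : f \in Lfun P 2%:E ->
  'E_P[fun w => (f w ^+ 2)%R] < +oo.
Proof.
move=> /Lfun2_integrable_sqr /integrableP[_]; rewrite unlock; apply: le_lt_trans.
rewrite le_eqVlt; apply/orP; left; apply/eqP.
by apply: eq_integral => w _ /=; rewrite ger0_norm// sqr_ge0.
Qed.

(** Cauchy-Schwarz, with each variance bounded by the second moment. *)
Lemma norm_covariance_le (X Y : T -> R) (u v : R) :
  X \in Lfun P 2%:E -> Y \in Lfun P 2%:E -> (0 <= u)%R -> (0 <= v)%R ->
  'E_P[fun w => (X w ^+ 2)%R] <= (u ^+ 2)%:E ->
  'E_P[fun w => (Y w ^+ 2)%R] <= (v ^+ 2)%:E ->
  `|covariance P X Y| <= (u * v)%:E.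
Proof.
move=> X2 Y2 u0 v0 Xu Yv.
have Pfin : P setT \is a fin_num := fin_num_measure P _ measurableT.
have X1 := Lfun_subset12 Pfin X2; have Y1 := Lfun_subset12 Pfin Y2.
have XY1 := Lfun2_mul_Lfun1 X2 Y2.
have sd (Z : T -> R) c : Z \in Lfun P 2%:E -> (0 <= c)%R ->
    'E_P[fun w => (Z w ^+ 2)%R] <= (c ^+ 2)%:E -> sqrte (variance P Z) <= c%:E.
  move=> Z2 c0 Zc; rewrite lee_sqrE ?sqrte_ge0// sqr_sqrte ?variance_ge0//.
  rewrite varianceE//; apply: le_trans Zc.
  by rewrite -[leRHS]sube0; apply: leeB; rewrite ?sqre_ge0.
(* Stated for any [Z] in order to serve for both [X] and [-X], which have the same variance; the two
   one-sided bounds give the absolute value. *)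
have bound (Z : T -> R) : Z \in Lfun P 2%:E ->
    sqrte (variance P Z) <= u%:E -> covariance P Z Y <= (u * v)%:E.
  move=> Z2 Zu; apply: le_trans (covariance_le Z2 Y2) _.
  by rewrite EFinM lee_pmul ?sqrte_ge0// sd.
have covE := fineK (covariance_fin_num X1 Y1 XY1).
rewrite -covE abse_EFin lee_fin ler_norml lerNl -!lee_fin EFinN !covE.
rewrite -covarianceNl// !bound ?rpredN//; first exact: sd.
by rewrite varianceN//; exact: sd.
Qed.

End square_integrable.

Section Lfun2_closure.
Context {d : measure_display} {T : measurableType d} {R : realType}.
Variable P : probability T R.

Lemma Lfun2_sum (I : Type) (s : seq I) (f : I -> T -> R) :
  (forall i, f i \in Lfun P 2%:E) ->
  (fun w => \sum_(i <- s) f i w) \in Lfun P 2%:E.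
Proof.
move=> f2; elim: s => [|i s IH].
  rewrite (_ : (fun w => _) = cst 0) ?Lfun_cst//.
  by apply/funext => w; rewrite big_nil.
rewrite (_ : (fun w => _) = f i \+ (fun w => \sum_(j <- s) f j w)); last first.
  by apply/funext => w; rewrite big_cons.
by rewrite rpredD// lee1n.
Qed.

Lemma Lfun2_norm (f : T -> R) : f \in Lfun P 2%:E ->
  (fun w => `|f w|) \in Lfun P 2%:E.
Proof.
move=> f2; apply: expectation_sqr_Lfun2.
  apply: measurableT_comp => //.
  by move: f2; rewrite inE => /andP[/[!inE]].
under eq_fun do rewrite real_normK ?num_real//.
exact: Lfun2_expectation_sqr.
Qed.

End Lfun2_closure.

(** * The path of the noise *)

Definition int_path (R : realType) : Type := int -> R.
HB.instance Definition _ (R : realType) := gen_eqMixin (int_path R).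
HB.instance Definition _ (R : realType) := gen_choiceMixin (int_path R).
HB.instance Definition _ (R : realType) := isPointed.Build (int_path R) (fun=> 0).

(** The sigma-algebra generated by these sets consists of the events decided by the coordinates in
    [I]. Measurability on [path_space R I] thus expresses that a function depends only on the noises
    with index in [I]. *)
Definition cylinders (R : realType) (I : pred int) : set (set (int_path R)) :=
  [set C | exists s (B : int -> set R), [/\ uniq s, all I s,
    (forall i, measurable (B i)) &
    C = [set x | forall i, i \in s -> B i (x i)]] ].

Notation path_space R I := (g_sigma_algebraType (cylinders R I)).

Section cylinders_theory.
Context {R : realType}.
Local Notation cylinders := (cylinders R).
Local Notation path_space I := (path_space R I).

Lemma cylinders_setI_closed I : setI_closed (cylinders I).
Proof.
move=> _ _ [s [B [us Is mB ->]]] [s' [B' [us' Is' mB' ->]]].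
exists (undup (s ++ s')), (fun i => (if i \in s then B i else setT) `&`
  (if i \in s' then B' i else setT)); split.
- exact: undup_uniq.
- apply/allP => i; rewrite mem_undup mem_cat => /orP[]; exact: allP.
- by move=> i; apply: measurableI; case: ifP.
- apply/seteqP; split => [x /= [h h'] i _|x /= h].
    by split; case: ifPn => // /[dup] ? ?; [exact: h|exact: h'].
  split => i si; have := h i; rewrite mem_undup mem_cat si ?orbT => /(_ isT).
    by move=> [].
  by move=> [].
Qed.

Lemma cylinders_setT I : cylinders I setT.
Proof.
exists [::], (fun=> setT); split => //.
by apply/seteqP; split.
Qed.

Lemma sub_cylinders (I J : pred int) :
  subpred I J -> cylinders I `<=` cylinders J.
Proof.
move=> IJ _ [s [B [us Is mB ->]]]; exists s, B; split => //.
exact: sub_all Is.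
Qed.

Lemma measurable_coord (I : pred int) i : I i ->
  measurable_fun [set: path_space I] (fun x : path_space I => x i).
Proof.
move=> Ii _ B mB; rewrite setTI; apply: sub_sigma_algebra.
exists [:: i], (fun=> B); split => //=; first by rewrite Ii.
by apply/seteqP; split => x /= => [h j /[!inE] /eqP ->//|]; apply; rewrite inE.
Qed.

Lemma measurable_path_space (I J : pred int) (f : int_path R -> R) :
  subpred I J -> measurable_fun [set: path_space I] f ->
  measurable_fun [set: path_space J] f.
Proof.
move=> IJ mf _ B mB; have := mf measurableT B mB; rewrite !setTI.
by apply: sub_smallest2r; [exact: smallest_sigma_algebra|exact: sub_cylinders].
Qed.

Definition path_shift (h : int) (x : int_path R) : int_path R :=
  fun i => x (h + i).

End cylinders_theory.

(** * Law of the shifted noise path *)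

Section iid_paths.
Context {d : measure_display} {T : measurableType d} {R : realType}.
Variables (P : probability T R) (e : int -> {RV P >-> R}).

Definition path_of (w : T) : int_path R := fun i => e i w.

(** The noise path seen from time [h], as a random element for the sigma-algebra of all coordinates;
    [h = 0] is the noise itself, up to the index [0 + i]. *)
Definition shift_path h : T -> path_space R predT :=
  fun w => path_shift h (path_of w).

Lemma measurable_shift_path h : measurable_fun [set: T] (shift_path h).
Proof.
apply: (@measurability _ _ T (path_space R predT) setT _ (cylinders R predT)) => //.
move=> _ [_ [s [B [us _ mB ->]]] <-]; rewrite setTI.
rewrite [X in measurable X](_ : _ =
    \big[setI/setT]_(i <- s) (e (h + i) @^-1` B i)).
  by apply: bigsetI_measurable => i _; rewrite -[X in measurable X]setTI;
    exact: measurable_funPT.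
rewrite -bigcap_seq; apply/seteqP; split => w /= hw i; exact: hw.
Qed.

HB.instance Definition _ h := isMeasurableFun.Build _ _ _ _
  (shift_path h) (measurable_shift_path h).

Lemma shift_path_cylinder h s (B : int -> set R) :
  shift_path h @^-1` [set x | forall i, i \in s -> B i (x i)] =
  \big[setI/setT]_(i <- s) (e (h + i) @^-1` B i).
Proof.
by rewrite -bigcap_seq; apply/seteqP; split => w /= hw i; exact: hw.
Qed.

Hypothesis iide : iid P (fun n => e n).

(** After reindexing by [h + i], independence gives a product whose factors are moved to index 0 by
    equality of laws. The value is free of [h], so it yields shift invariance as well as
    independence of disjoint blocks. *)
Lemma iid_cylinder h s (B : int -> set R) : uniq s ->
  (forall i, measurable (B i)) ->
  P (shift_path h @^-1` [set x | forall i, i \in s -> B i (x i)]) =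
  (\prod_(i <- s) P (e 0%Z @^-1` B i))%E.
Proof.
move=> us mB; rewrite shift_path_cylinder.
have -> : \big[setI/setT]_(i <- s) (e (h + i) @^-1` B i) =
    \big[setI/setT]_(j <- [seq h + i | i <- s]) (e j @^-1` B (j - h)).
  by rewrite big_map; apply: eq_bigr => i _; rewrite addrAC subrr add0r.
rewrite (iide.1 _ (fun j => B (j - h)))//; last first.
  by rewrite map_inj_uniq// => i j /addrI.
rewrite big_map; apply: eq_bigr => i _; rewrite addrAC subrr add0r.
exact: iide.2.
Qed.

Lemma shift_path_invariant h (A : set (path_space R predT)) : measurable A ->
  P (shift_path h @^-1` A) = P (shift_path 0 @^-1` A).
Proof.
move=> mA.
apply: (probability_eq_g_sigma_algebra (distribution P (shift_path h))
  (distribution P (shift_path 0)) (cylinders R predT)) => //.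
- exact: sub_sigma_algebra.
- exact: cylinders_setI_closed.
- exact: cylinders_setT.
- move=> _ [s [B [us _ mB ->]]].
  by transitivity (\prod_(i <- s) P (e 0%Z @^-1` B i))%E;
    [|apply/esym]; apply: iid_cylinder.
Qed.

(** Cylinders over disjoint index sets intersect in a cylinder over the concatenated list, whose
    probability factors; the pi-system argument does the rest. *)
Lemma shift_path_indep (I J : pred int) (A B : set (int_path R)) :
  (forall i, I i -> ~~ J i) ->
  @measurable _ (path_space R I) A -> @measurable _ (path_space R J) B ->
  P (shift_path 0 @^-1` A `&` shift_path 0 @^-1` B) =
  (P (shift_path 0 @^-1` A) * P (shift_path 0 @^-1` B))%E.
Proof.
move=> IJ mA mB.
have cylm K : cylinders R K `<=` @measurable _ (path_space R predT).
  by move=> C KC; apply: sub_sigma_algebra; exact: sub_cylinders KC.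
apply: (indep_g_sigma_algebra (distribution P (shift_path 0))
    (cylinders R I) (cylinders R J)) => //;
  try exact: cylm; try exact: cylinders_setI_closed; try exact: cylinders_setT.
move=> _ _ [s [C [us Is mC ->]]] [s' [C' [us' Js' mC' ->]]].
have dss' i : i \in s -> i \in s' -> False.
  by move=> /(allP Is)/IJ/negP Ji /(allP Js').
have -> : [set x : int_path R | forall i, i \in s -> C i (x i)] `&`
          [set x | forall i, i \in s' -> C' i (x i)] =
    [set x | forall i, i \in s ++ s' -> (if i \in s then C i else C' i) (x i)].
  apply/seteqP; split => [x /= [h h'] i|x /= h].
    by rewrite mem_cat; case: ifPn => /= [+ _|_]; [exact: h|exact: h'].
  split => i si; have := h i; rewrite mem_cat si ?orbT => /(_ isT)//.
  by case: ifPn => // /dss'.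
transitivity (\prod_(i <- s ++ s')
    P (e 0%Z @^-1` (if i \in s then C i else C' i)))%E.
  apply: (iid_cylinder 0 (s ++ s') (fun i => if i \in s then C i else C' i)).
    rewrite cat_uniq us us' andbT; apply/hasPn => i s'i; apply/negP => si.
    exact: dss' si s'i.
  by move=> i; case: ifP.
rewrite big_cat/=; congr (_ * _)%E.
  transitivity (\prod_(i <- s) P (e 0%Z @^-1` C i))%E.
    by apply: eq_big_seq => i ->.
  exact/esym/iid_cylinder.
transitivity (\prod_(i <- s') P (e 0%Z @^-1` C' i))%E.
  by apply: eq_big_seq => i s'i; case: ifPn => // /dss'.
exact/esym/iid_cylinder.
Qed.

End iid_paths.

Section independent_functions_of_paths.
Context {d : measure_display} {T : measurableType d} {R : realType}.
Variables (P : probability T R) (e : int -> {RV P >-> R}).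
Hypothesis iide : iid P (fun n => e n).
Variables (I J : pred int) (f g : int_path R -> R).
Hypotheses (IJ : forall i, I i -> ~~ J i)
  (mf : measurable_fun [set: path_space R I] f)
  (mg : measurable_fun [set: path_space R J] g).

Let X w := f (shift_path P e 0 w).
Let Y w := g (shift_path P e 0 w).

Let mX : measurable_fun [set: T] X.
Proof.
apply: (@measurableT_comp _ _ _ _ (path_space R predT) _ f).
  exact: measurable_path_space mf.
exact: measurable_shift_path.
Qed.

Let mY : measurable_fun [set: T] Y.
Proof.
apply: (@measurableT_comp _ _ _ _ (path_space R predT) _ g).
  exact: measurable_path_space mg.
exact: measurable_shift_path.
Qed.

HB.instance Definition _ := isMeasurableFun.Build _ _ _ _ X mX.
HB.instance Definition _ := isMeasurableFun.Build _ _ _ _ Y mY.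

Let indepXY (A B : set R) : measurable A -> measurable B ->
  P (X @^-1` A `&` Y @^-1` B) = (P (X @^-1` A) * P (Y @^-1` B))%E.
Proof.
move=> mA mB.
apply: (shift_path_indep P e iide I J (f @^-1` A) (g @^-1` B) IJ).
  by rewrite -[X in measurable X]setTI; exact: mf.
by rewrite -[X in measurable X]setTI; exact: mg.
Qed.

Lemma path_ge0_expectationM : (forall x, 0 <= f x) -> (forall x, 0 <= g x) ->
  ('E_P[fun w => (f (shift_path P e 0 w) * g (shift_path P e 0 w))%R] =
  'E_P[fun w => f (shift_path P e 0 w)] * 'E_P[fun w => g (shift_path P e 0 w)])%E.
Proof.
by move=> f0 g0; apply: (indep_ge0_expectationM P X Y indepXY) => w;
  [exact: f0|exact: g0].
Qed.

Lemma path_covariance0 :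
  (fun w => f (shift_path P e 0 w)) \in Lfun P 2%:E ->
  (fun w => g (shift_path P e 0 w)) \in Lfun P 2%:E ->
  covariance P (fun w => f (shift_path P e 0 w))
    (fun w => g (shift_path P e 0 w)) = 0%E.
Proof. exact: (indep_covariance0 P X Y indepXY). Qed.

End independent_functions_of_paths.

Section shift_expectation.
Context {d : measure_display} {T : measurableType d} {R : realType}.
Variables (P : probability T R) (e : int -> {RV P >-> R}).
Hypothesis iide : iid P (fun n => e n).

Lemma shift_expectation (f : int_path R -> R) h :
  measurable_fun [set: path_space R predT] f -> (forall x, 0 <= f x) ->
  ('E_P[fun w => f (shift_path P e h w)] = 'E_P[fun w => f (shift_path P e 0 w)])%E.
Proof.
move=> mf f0.
have mEf : measurable_fun [set: path_space R predT] (EFin \o f).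
  exact/measurable_EFinP.
have Ef0 x : (0 <= (f x)%:E)%E by rewrite lee_fin.
have E k : ('E_P[fun w => f (shift_path P e k w)] =
    \int[distribution P (shift_path P e k)]_x (f x)%:E)%E.
  by rewrite ge0_integral_distribution// unlock.
rewrite !E; apply: eq_measure_integral => A mA _.
exact: (shift_path_invariant P e iide h A mA).
Qed.

End shift_expectation.

(** * The threshold recursion along one path *)

Section threshold_recursion.
Context {R : realType}.
Variables (q d : nat) (r mu1 mu2 : R) (phi psi : nat -> R).
Implicit Types (x : int_path R) (n : int) (m j : nat).

Definition moving_average (mu : R) (theta : nat -> R) x n :=
  mu + x n + \sum_(1 <= i < q.+1) theta i * x (n - i%:Z).

(* [b_n] and [a_n] of the theorem, as functions of the noise path. *)
Definition lower := moving_average mu1 phi.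
Definition upper := moving_average mu2 psi.

(* The recursion started [m] steps earlier, at [n - m d], in the lower regime. *)
Fixpoint truncated m x n : R :=
  if m is m'.+1 then
    if truncated m' x (n - d%:Z) <= r then lower x n else upper x n
  else lower x n.

Definition coupling x n := (upper x n <= r) == (lower x n <= r).

(** Solution and truncation can differ at [n] only if they choose different regimes there, that is,
    lie on different sides of [r] at [n - d]. *)
Lemma truncated_eq x (z : int -> R) m n :
  (forall k, z k = if z (k - d%:Z) <= r then lower x k else upper x k) ->
  forall j, (0 < j <= m)%N -> coupling x (n - (j * d)%N%:Z) ->
  z n = truncated m x n.
Proof.
move=> zE; elim: m n => [n [//|//]|m IH n j /andP[j0 jm] cj].
rewrite /= [LHS]zE.
suff -> : (z (n - d%:Z) <= r) = (truncated m x (n - d%:Z) <= r) by [].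
(* A coupling at lag [j > 1] has lag [j - 1] seen from [n - d], so induction applies. For [j = 1]
   both values at [n - d] are among the two moving averages, which lie on the same side of [r]. *)
have [j1|j1] := leqP j 1; last first.
  rewrite (IH (n - d%:Z) j.-1)//; first by lia.
  rewrite (_ : _ - _ - _ = n - (j * d)%N%:Z)//; first by lia.
have {j1 j0 jm}j1 : j = 1%N by lia.
move: cj; rewrite j1 mul1n zE => /eqP cj.
have tE : truncated m x (n - d%:Z) = lower x (n - d%:Z) \/
          truncated m x (n - d%:Z) = upper x (n - d%:Z).
  by case: m {IH} => [|m] /=; [left|case: ifP => _; [left|right]].
by case: ifP => _; case: tE => ->.
Qed.

(** Bounds the solution, every truncation and their difference, uniformly in the depth [m], while
    involving only [q + 1] noises. *)
Definition envelope x n := `|lower x n| + `|upper x n|.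

Lemma truncated_dist x (z : int -> R) m n :
  (forall k, z k = if z (k - d%:Z) <= r then lower x k else upper x k) ->
  `|z n - truncated m x n| <= envelope x n.
Proof.
rewrite /envelope => zE.
have tE : truncated m x n = lower x n \/ truncated m x n = upper x n.
  by case: m => [|m] /=; [left|case: ifP => _; [left|right]].
rewrite zE; case: ifP => _; case: tE => ->; rewrite ?subrr ?normr0 ?addr_ge0 ?ler_normB//.
by rewrite [leRHS]addrC ler_normB.
Qed.

Lemma norm_truncated x m n :
  `|truncated m x n| <= envelope x n.
Proof.
rewrite /envelope.
have tE : truncated m x n = lower x n \/ truncated m x n = upper x n.
  by case: m => [|m] /=; [left|case: ifP => _; [left|right]].
by case: tE => ->; rewrite ?lerDl ?lerDr.
Qed.

(** Only every [L]-th time is inspected: for [L > q] the conditions read disjoint blocks of noise.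
    Time [n] itself is left out, hence [s.+1]. *)
Definition uncoupled (L M : nat) x n :=
  all (fun s => ~~ coupling x (n - (s.+1 * L)%N%:Z)) (iota 0 M).

Lemma uncoupledS L M x n : uncoupled L M.+1 x n =
  uncoupled L M x n && ~~ coupling x (n - (M.+1 * L)%N%:Z).
Proof. by rewrite /uncoupled -[in LHS]addn1 iotaD all_cat/= add0n andbT. Qed.

Lemma truncated_neq_uncoupled x (z : int -> R) M n c :
  (forall k, z k = if z (k - d%:Z) <= r then lower x k else upper x k) ->
  z n != truncated (c.+1 * M) x n -> uncoupled (c.+1 * d) M x n.
Proof.
move=> zE; apply: contraNT => /allPn[s]; rewrite mem_iota add0n => sM.
rewrite negbK => cs; apply/eqP.
(* The lag [(s + 1) (c + 1) d] is reached after [(s + 1) (c + 1)] steps of length [d], which is at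
   most [(c + 1) M]. *)
apply: (truncated_eq _ _ _ _ zE (s.+1 * c.+1)); first by nia.
by rewrite -mulnA.
Qed.

Lemma moving_average_shift mu theta x n :
  moving_average mu theta (path_shift n x) 0 = moving_average mu theta x n.
Proof.
rewrite /moving_average /path_shift addr0; congr (_ + _).
by apply: eq_bigr => i _; rewrite sub0r.
Qed.

Lemma coupling_shift x n : coupling (path_shift n x) 0 = coupling x n.
Proof. by rewrite /coupling /lower /upper !moving_average_shift. Qed.

Lemma envelope_shift x n : envelope (path_shift n x) 0 = envelope x n.
Proof. by rewrite /envelope /lower /upper !moving_average_shift. Qed.

(** * Measurability and range of dependence on the noise *)

Section measurability.
Variable I : pred int.
Local Notation path := (path_space R I).

Lemma measurable_moving_average mu theta n :
  (forall j, (j <= q)%N -> I (n - j%:Z)) ->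
  measurable_fun [set: path] (fun x : path => moving_average mu theta x n).
Proof.
move=> In; apply: measurable_funD.
  apply: measurable_funD => //; apply: measurable_coord.
  by have := In 0%N (leq0n _); rewrite subr0.
under eq_fun do rewrite big_add1 big_mkord.
apply: measurable_sum => i; apply: measurable_funM => //.
by apply: measurable_coord; apply: In; exact: ltn_ord.
Qed.

Lemma measurable_envelope n :
  (forall j, (j <= q)%N -> I (n - j%:Z)) ->
  measurable_fun [set: path] (fun x : path => envelope x n).
Proof.
by move=> In; apply: measurable_funD; apply: measurableT_comp => //;
  apply: measurable_moving_average.
Qed.

(** Each step goes back by [d] and the last moving average by [q] more, so no noise before
    [n - (m d + q)] is read. *)
Lemma measurable_truncated m n :
  (forall j, (j <= m * d + q)%N -> I (n - j%:Z)) ->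
  measurable_fun [set: path] (fun x : path => truncated m x n).
Proof.
elim: m n => [|m IH] n In /=.
  by apply: measurable_moving_average => j jq; apply: In; rewrite mul0n.
have Iq j : (j <= q)%N -> I (n - j%:Z).
  by move=> jq; apply: In; rewrite (leq_trans jq)// leq_addl.
apply: measurable_fun_ifT; try exact: measurable_moving_average.
apply: measurable_fun_ler => //; apply: IH => j jm.
by rewrite -addrA -opprD -PoszD; apply: In; lia.
Qed.

Lemma measurable_coupling n :
  (forall j, (j <= q)%N -> I (n - j%:Z)) ->
  measurable_fun [set: path] (fun x : path => coupling x n).
Proof.
move=> In.
rewrite (_ : (fun x => _) = fun x : path =>
  if lower x n <= r then upper x n <= r else ~~ (upper x n <= r)); last first.
  by apply/funext => x; rewrite /coupling; do 2 case: (_ <= _).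
have mle mu theta :
    measurable_fun [set: path] (fun x : path => moving_average mu theta x n <= r).
  by apply: measurable_fun_ler => //; exact: measurable_moving_average.
by apply: measurable_fun_ifT; last apply: measurable_neg; exact: mle.
Qed.

Lemma measurable_uncoupled L M n :
  (forall s j, (s < M)%N -> (j <= q)%N -> I (n - (s.+1 * L)%N%:Z - j%:Z)) ->
  measurable_fun [set: path] (fun x : path => uncoupled L M x n).
Proof.
elim: M => [_|M IH In]; first exact: measurable_cst.
under eq_fun do rewrite uncoupledS.
apply: measurable_and.
  by apply: IH => s j sM; apply: In; rewrite ltnS ltnW.
by apply: measurable_neg; apply: measurable_coupling => j; exact: In.
Qed.

End measurability.
End threshold_recursion.

(** * Decay of covariances *)

Section real_powers.
Context {R : realType}.

Lemma bernoulli_lower (t : R) N : 0 <= t <= 1 -> 1 - N%:R * t <= (1 - t) ^+ N.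
Proof.
move=> /andP[t0 t1]; elim: N => [|N IH]; first by rewrite mul0r subr0 expr0.
have N0 : 0 <= N%:R :> R by [].
rewrite exprS; apply: le_trans (_ : (1 - t) * (1 - N%:R * t) <= _).
  by rewrite -natr1; nra.
by rewrite ler_wpM2l// subr_ge0.
Qed.

Lemma exists_power_ge (beta : R) N : (0 < N)%N -> 0 <= beta < 1 ->
  exists rho : R, 0 < rho < 1 /\ beta <= rho ^+ N.
Proof.
(* Bernoulli gives [(1 - t) ^+ N >= 1 - N t = beta + t]. Dividing by [N + 1] instead of [N] keeps
   [rho = 1 - t] positive even for [beta = 0] and [N = 1]. *)
move=> N0 /andP[b0 b1]; pose t := (1 - beta) / N.+1%:R.
have N1 : 2 <= N.+1%:R :> R by rewrite ler_nat.
have tE : t * N.+1%:R = 1 - beta by rewrite /t divfK// pnatr_eq0.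
have t0 : 0 < t by rewrite divr_gt0// subr_gt0.
have t1 : t < 1 by nra.
exists (1 - t); split; first by apply/andP; split; lra.
apply: le_trans (bernoulli_lower t N _); last by rewrite !ltW.
by move: tE; rewrite -natr1; nra.
Qed.

End real_powers.

(** * Second moments, truncation error and covariances of a solution *)

Section threshold_process.
Context {dT : measure_display} {T : measurableType dT} {R : realType}.
Variables (P : probability T R) (e : int -> {RV P >-> R}).
Variables (q d : nat) (r mu1 mu2 : R) (phi psi : nat -> R).
Hypothesis iide : iid P (fun n => e n).
Hypothesis d0 : (0 < d)%N.

Local Notation S := (shift_path P e 0).
Local Notation lower := (lower q mu1 phi).
Local Notation upper := (upper q mu2 psi).
Local Notation envelope := (envelope q mu1 mu2 phi psi).
Local Notation truncated := (truncated q d r mu1 mu2 phi psi).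
Local Notation coupling := (coupling q r mu1 mu2 phi psi).
Local Notation L := (q.+1 * d)%N.
Local Notation uncoupled := (uncoupled q r mu1 mu2 phi psi L).

Let qL : (q < L)%N. Proof. by nia. Qed.

Lemma measurable_path_comp (f : int_path R -> R) :
  measurable_fun [set: path_space R predT] f ->
  measurable_fun [set: T] (fun w => f (S w)).
Proof.
move=> mf; apply: (@measurableT_comp _ _ _ _ (path_space R predT) _ f) => //.
Qed.

Lemma probability_uncoupled (beta : R) M n : 0 <= beta ->
  (forall m, P (S @^-1` [set x | ~~ coupling x m]) <= beta%:E)%E ->
  (P (S @^-1` [set x | uncoupled M x n]) <= (beta ^+ M)%:E)%E.
Proof.
move=> b0 Pb; elim: M => [|M IH].
  rewrite expr0 (_ : S @^-1` _ = setT) ?probability_setT//.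
  by apply/seteqP; split.
(* Since [q < L], the first [M] conditions read only noises after [n - (M + 1) L], and the last one
   only noises up to that time, so they are independent. *)
pose I : pred int := fun i => n - (M.+1 * L)%N%:Z < i.
pose J : pred int := fun i => i <= n - (M.+1 * L)%N%:Z.
rewrite (_ : S @^-1` _ = S @^-1` [set x | uncoupled M x n] `&`
    S @^-1` [set x | ~~ coupling x (n - (M.+1 * L)%N%:Z)]); last first.
  apply/seteqP; split => w /=; rewrite uncoupledS; first by move/andP.
  by move=> [? ?]; apply/andP.
rewrite (shift_path_indep P e iide I J).
- by rewrite exprSr EFinM lee_pmul.
- by move=> i; rewrite /I /J ltNge.
- have mu : measurable_fun [set: path_space R I] (fun x => uncoupled M x n).
    by apply: measurable_uncoupled => s j sM jq; rewrite /I; nia.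
  by have := mu measurableT [set true]; rewrite setTI; apply.
- have mc : measurable_fun [set: path_space R J]
      (fun x => ~~ coupling x (n - (M.+1 * L)%N%:Z)).
    by apply: measurable_neg; apply: measurable_coupling => j jq; rewrite /J; lia.
  by have := mc measurableT [set true]; rewrite setTI; apply.
Qed.

(** By shift invariance coupling fails with the same probability at every time, so [beta] is one
    minus the probability of coupling at time 0. *)
Lemma exists_decoupling_bound :
  P (S @^-1` [set x | coupling x 0]) != 0%E ->
  exists beta : R, 0 <= beta < 1 /\
    forall m, (P (S @^-1` [set x | ~~ coupling x m]) <= beta%:E)%E.
Proof.
move=> P0.
have mc : measurable ([set x | coupling x 0] : set (path_space R predT)).
  rewrite -[X in measurable X]setTI.
  exact: (measurable_coupling q r mu1 mu2 phi psi predT 0 _ measurableT [set true]).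
have mS (A : set (path_space R predT)) : measurable A -> measurable (S @^-1` A).
  move=> mA; rewrite -[X in measurable X]setTI.
  exact: (measurable_shift_path P e 0 measurableT A mA).
have Pm m : P (S @^-1` [set x | ~~ coupling x m]) =
    (1 - P (S @^-1` [set x | coupling x 0]))%E.
  have -> : S @^-1` [set x | ~~ coupling x m] =
      shift_path P e m @^-1` (~` [set x | coupling x 0]).
    apply/seteqP; split=> w /=; rewrite -(coupling_shift _ _ _ _ _ _ _ m);
      rewrite (_ : path_shift m (S w) = shift_path P e m w);
      try by move/negP.
      by apply/funext => i; rewrite /shift_path /path_shift add0r.
    by apply/funext => i; rewrite /shift_path /path_shift add0r.
  rewrite (shift_path_invariant P e iide m); last exact: measurableC.
  by rewrite preimage_setC probability_setC//; exact: (mS _ mc).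
have Pfin : P (S @^-1` [set x | coupling x 0]) \is a fin_num.
  by apply: fin_num_measure; exact: (mS _ mc).
exists (1 - fine (P (S @^-1` [set x | coupling x 0]))); split; last first.
  by move=> m; rewrite Pm EFinB fineK.
rewrite subr_ge0 -lee_fin fineK// probability_le1/=; last exact: (mS _ mc).
by rewrite gtrBl fine_gt0// lt_neqAle eq_sym P0 measure_ge0 ltey_eq Pfin.
Qed.

Hypothesis e2 : ('E_P[fun w => (e 1%Z w ^+ 2)%R] < +oo)%E.

Lemma noise_Lfun2 n : (e n : T -> R) \in Lfun P 2%:E.
Proof.
apply: expectation_sqr_Lfun2 => //.
have mc : measurable_fun [set: path_space R predT]
    (fun x : path_space R predT => x 0 ^+ 2).
  by apply: measurable_funX; exact: measurable_coord.
have E k : ('E_P[fun w => (e k w ^+ 2)%R] =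
    'E_P[fun w => (e 0%R w ^+ 2)%R])%E.
  have := shift_expectation P e iide (fun x => x 0 ^+ 2) k mc (fun x => sqr_ge0 _).
  rewrite /shift_path /path_shift /path_of addr0 => ->.
  by rewrite addr0.
by rewrite E -(E 1%Z).
Qed.

Lemma moving_average_Lfun2 mu theta n :
  (fun w => moving_average q mu theta (S w) n) \in Lfun P 2%:E.
Proof.
have -> : (fun w => moving_average q mu theta (S w) n) =
    (cst mu \+ e (0 + n)) \+
    (fun w => \sum_(1 <= i < q.+1) (theta i \o* e (0 + (n - i%:Z))) w).
  apply/funext => w; congr (_ + _); apply: eq_bigr => i _ /=.
  by rewrite mulrC.
have p1 : (1 <= 2%:E :> \bar R)%E by rewrite lee1n.
rewrite rpredD//.
  by rewrite rpredD//; [exact: Lfun_cst|exact: noise_Lfun2].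
apply: (Lfun2_sum P _ _ (fun i => theta i \o* e (0 + (n - i%:Z)))) => i.
by rewrite Lfun_scale ?noise_Lfun2// ler1n.
Qed.

Lemma envelope_Lfun2 n : (fun w => envelope (S w) n) \in Lfun P 2%:E.
Proof.
rewrite (_ : (fun w => _) = (fun w => `|lower (S w) n|) \+
  (fun w => `|upper (S w) n|))//.
have p1 : (1 <= 2%:E :> \bar R)%E by rewrite lee1n.
by rewrite rpredD//; apply: Lfun2_norm; exact: moving_average_Lfun2.
Qed.

Lemma expectation_envelope n :
  ('E_P[fun w => (envelope (S w) n ^+ 2)%R] =
   'E_P[fun w => (envelope (S w) 0 ^+ 2)%R])%E.
Proof.
have me : measurable_fun [set: path_space R predT]
    (fun x : path_space R predT => envelope x 0 ^+ 2).
  by apply: measurable_funX; exact: measurable_envelope.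
rewrite -(shift_expectation P e iide _ n me (fun x => sqr_ge0 _)).
congr expectation; apply/funext => w; congr (_ ^+ 2).
have -> : shift_path P e n w = path_shift n (S w).
  by apply/funext => i; rewrite /shift_path /path_shift add0r.
by rewrite envelope_shift.
Qed.

Lemma measurable_truncated_path m n :
  measurable_fun [set: T] (fun w => truncated m (S w) n).
Proof.
by apply: (measurable_path_comp (fun x => truncated m x n)); exact: measurable_truncated.
Qed.

Lemma expectation_le_envelope (f : T -> R) n : measurable_fun [set: T] f ->
  {ae P, forall w, `|f w| <= envelope (S w) n} ->
  ('E_P[fun w => (f w ^+ 2)%R] <= 'E_P[fun w => (envelope (S w) 0 ^+ 2)%R])%E.
Proof.
move=> mf fle; rewrite -(expectation_envelope n).
have me : measurable_fun [set: T] (fun w => envelope (S w) n).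
  apply: (measurable_path_comp (fun x => envelope x n)).
  exact: measurable_envelope.
apply: expectation_le; try exact: measurable_funX; try by move=> w; exact: sqr_ge0.
apply: filterS fle => w fw.
by rewrite -[leLHS]real_normK ?num_real// ler_sqr ?nnegrE ?(le_trans _ fw).
Qed.

Lemma envelope_bounded_Lfun2 (f : T -> R) n : measurable_fun [set: T] f ->
  {ae P, forall w, `|f w| <= envelope (S w) n} -> f \in Lfun P 2%:E.
Proof.
move=> mf fle; apply: expectation_sqr_Lfun2 => //.
apply: le_lt_trans (expectation_le_envelope f n mf fle) _.
exact: (Lfun2_expectation_sqr P _ (envelope_Lfun2 0)).
Qed.

Variable y : int -> {RV P >-> R}.
Hypothesis ysol : {ae P, forall w, forall k,
  y k w = if y (k - d%:Z) w <= r then lower (S w) k else upper (S w) k}.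

Lemma solution_le_envelope n : {ae P, forall w, `|y n w| <= envelope (S w) n}.
Proof.
apply: filterS ysol => w ->.
by case: ifP => _; rewrite ?lerDl ?lerDr.
Qed.

Lemma error_le_envelope m n :
  {ae P, forall w, `|y n w - truncated m (S w) n| <= envelope (S w) n}.
Proof.
apply: filterS ysol => w yw.
exact: (truncated_dist q d r mu1 mu2 phi psi (S w) (fun k => y k w) m n yw).
Qed.

(** The error vanishes unless [uncoupled] holds and is otherwise at most the envelope. The envelope
    at [n] reads noises from [n - q] on, [uncoupled] only earlier ones, so the expectation factors
    and second moments are enough. *)
Lemma truncation_error (beta : R) M n : 0 <= beta ->
  (forall m, P (S @^-1` [set x | ~~ coupling x m]) <= beta%:E)%E ->
  ('E_P[fun w => ((y n w - truncated (q.+1 * M) (S w) n) ^+ 2)%R] <=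
   'E_P[fun w => (envelope (S w) 0 ^+ 2)%R] * (beta ^+ M)%:E)%E.
Proof.
move=> b0 Pb.
pose I : pred int := fun i => n - q%:Z <= i.
pose J : pred int := fun i => i < n - q%:Z.
pose f x := envelope x n ^+ 2.
pose g (x : int_path R) : R := if uncoupled M x n then 1 else 0.
have mf (K : pred int) : (forall j, (j <= q)%N -> K (n - j%:Z)) ->
    measurable_fun [set: path_space R K] f.
  by move=> Kn; apply: measurable_funX; exact: measurable_envelope.
have mu (K : pred int) : (forall s j, (s < M)%N -> (j <= q)%N ->
      K (n - (s.+1 * L)%N%:Z - j%:Z)) ->
    measurable_fun [set: path_space R K] (fun x => uncoupled M x n).
  by move=> Kn; apply: measurable_uncoupled.
have mg (K : pred int) : (forall s j, (s < M)%N -> (j <= q)%N ->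
      K (n - (s.+1 * L)%N%:Z - j%:Z)) ->
    measurable_fun [set: path_space R K] g.
  by move=> Kn; apply: measurable_fun_ifT => //; exact: mu.
have f0 x : 0 <= f x by exact: sqr_ge0.
have g0 x : 0 <= g x by rewrite /g; case: ifP.
apply: (@le_trans _ _ ('E_P[fun w => (f (S w) * g (S w))%R])%E).
  apply: expectation_le.
  - apply: measurable_funX; apply: measurable_funB => //.
    exact: measurable_truncated_path.
  - by apply: measurable_funM;
      [apply: (measurable_path_comp f)|apply: (measurable_path_comp g)];
      [exact: mf|exact: mg].
  - by move=> w; exact: sqr_ge0.
  - by move=> w; rewrite mulr_ge0.
  have := error_le_envelope (q.+1 * M) n.
  apply: filterS2 ysol => w yw ew; rewrite /g.
  case: ifPn => [_|]; last first.
    rewrite mulr0; apply: contraNT => yt.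
    apply: (truncated_neq_uncoupled q d r mu1 mu2 phi psi (S w)
      (fun k => y k w) M n q yw).
    apply: contraNN yt => /eqP ->.
    by rewrite subrr expr0n.
  rewrite mulr1 /f -[leLHS]real_normK ?num_real//.
  by rewrite ler_sqr ?nnegrE ?(le_trans _ ew).
rewrite (path_ge0_expectationM P e iide I J f g) => //.
- rewrite /f expectation_envelope lee_wpmul2l//.
    by apply: expectation_ge0 => w; exact: sqr_ge0.
  rewrite (_ : (fun w => g (S w)) = \1_(S @^-1` [set x | uncoupled M x n])).
    rewrite expectation_indic; first exact: probability_uncoupled.
    have mA : measurable ([set: path_space R predT] `&`
        (fun x => uncoupled M x n) @^-1` [set true]).
      exact: mu.
    by have := measurable_shift_path P e 0 measurableT _ mA; rewrite !setTI.
  apply/funext => w; rewrite /g indicE; case: ifPn => h.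
    by rewrite mem_set.
  by rewrite memNset//; exact/negP.
- by move=> i; rewrite /I /J -leNgt.
- by apply: mf => j jq; rewrite /I; lia.
- by apply: mg => s j sM jq; rewrite /J; nia.
Qed.

Lemma covariance_solution_le (kappa rho : R) k :
  0 <= kappa -> 0 < rho < 1 ->
  ('E_P[fun w => (envelope (S w) 0 ^+ 2)%R] <= (kappa ^+ 2)%:E)%E ->
  (forall m, P (S @^-1` [set x | ~~ coupling x m]) <= (rho ^+ (L * 2))%:E)%E ->
  (`|covariance P (y 0) (y k%:Z)| <=
    (kappa ^+ 2 * rho ^+ (L * (k %/ L).-1) *+ 2)%:E)%E.
Proof.
move=> k0 /andP[r0 r1] Ek Pb.
have y2 n : (y n : T -> R) \in Lfun P 2%:E.
  by apply: envelope_bounded_Lfun2 (solution_le_envelope n).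
have Ey n : ('E_P[fun w => (y n w ^+ 2)%R] <= (kappa ^+ 2)%:E)%E.
  apply: le_trans Ek.
  by apply: (expectation_le_envelope _ n) (solution_le_envelope n).
(* For [k < L] the quotient is 0 and so is its predecessor: the claim follows from plain
   Cauchy-Schwarz. *)
have [kL|Lk] := ltnP k L.
  rewrite divn_small//= muln0 expr0 mulr1.
  apply: le_trans (norm_covariance_le P _ _ _ _ (y2 _) (y2 _) k0 k0 (Ey _) (Ey _)) _.
  by rewrite lee_fin -expr2 mulr2n lerDl sqr_ge0.
(* The truncation at [k] reaches back [M L + q] steps. One block is given up in [M] so that this
   stays below [k], leaving only noises after time 0. *)
set M := (k %/ L).-1; pose m := (q.+1 * M)%N.
have kM : (M * L + L <= k)%N.
  rewrite /M addnC -mulSn prednK ?leq_trunc_div// divn_gt0//.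
  exact: leq_ltn_trans qL.
pose t n := fun w => truncated m (S w) n.
have mt n : measurable_fun [set: T] (t n) by exact: measurable_truncated_path.
have tle n : {ae P, forall w, `|t n w| <= envelope (S w) n}.
  by apply: aeW => w; exact: norm_truncated.
have t2 n : t n \in Lfun P 2%:E by apply: envelope_bounded_Lfun2 (tle n).
have Et n : ('E_P[fun w => (t n w ^+ 2)%R] <= (kappa ^+ 2)%:E)%E.
  by apply: le_trans Ek; apply: expectation_le_envelope (tle n).
pose u n := y n \- t n.
have u2 n : u n \in Lfun P 2%:E by rewrite rpredB// lee1n.
have tau0 : 0 <= kappa * rho ^+ (L * M) by rewrite mulr_ge0// exprn_ge0 ?ltW.
(* The 2 in the exponent [L * 2] is absorbed by the square, so the error has L^2 norm at most
   [kappa * rho ^+ (L * M)]. *)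
have Eu n : ('E_P[fun w => (u n w ^+ 2)%R] <= ((kappa * rho ^+ (L * M)) ^+ 2)%:E)%E.
  apply: le_trans (truncation_error _ M n _ Pb) _; first by rewrite exprn_ge0 ?ltW.
  rewrite exprMn -!exprM EFinM mulnAC lee_wpmul2r// lee_fin exprn_ge0 ?ltW//.
have ytu n : (y n : T -> R) = u n \+ t n.
  by apply/funext => w; rewrite /u /= subrK.
have cov0 : covariance P (t 0) (t k%:Z) = 0%E.
  pose I : pred int := fun i => i <= 0.
  pose J : pred int := fun i => 0 < i.
  apply: (path_covariance0 P e iide I J (fun x => truncated m x 0)
    (fun x => truncated m x k%:Z)) => //.
  - by move=> i; rewrite /I /J -leNgt.
  - by apply: measurable_truncated => j _; rewrite /I; lia.
  - by apply: measurable_truncated => j jm; rewrite /J; nia.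
  - exact: t2.
  - exact: t2.
(* Bilinearity with [y = u + t]: the term with two truncations vanishes, and each remaining term
   contains one small factor [u]. *)
have -> : covariance P (y 0) (y k%:Z) =
    (covariance P (u 0%R) (y k%:Z) + covariance P (t 0%R) (u k%:Z))%E.
  rewrite [in LHS]ytu covarianceDl//; congr (_ + _)%E.
  by rewrite ytu covarianceDr// cov0 adde0.
apply: le_trans (lee_abs_add _ _) _.
rewrite mulr2n EFinD; apply: leeD.
  apply: le_trans (norm_covariance_le P _ _ _ _ (u2 _) (y2 _) tau0 k0 (Eu _) (Ey _)) _.
  by rewrite lee_fin expr2 mulrAC.
apply: le_trans (norm_covariance_le P _ _ _ _ (t2 _) (u2 _) k0 tau0 (Et _) (Eu _)) _.
by rewrite lee_fin expr2 mulrA.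
Qed.

End threshold_process.

(** Unrolling the recursion uses the equation at many times along one sample path, so the null sets
    must be merged; the integers are split into two sequences. *)
Lemma ae_forall_int (d : measure_display) (T : measurableType d) (R : realType)
  (mu : {measure set T -> \bar R}) (Q : int -> T -> Prop) :
  (forall n, {ae mu, forall w, Q n w}) -> {ae mu, forall w, forall n, Q n w}.
Proof.
move=> h.
have hP := ae_foralln (fun n => h (Posz n)).
have hN := ae_foralln (fun n => h (Negz n)).
by apply: filterS2 hP hN => w wP wN [].
Qed.

(** * Exponential decay of the autocovariances *)

Theorem theorem3p1 (dT : measure_display) (T : measurableType dT) (R : realType)
  (P : probability T R) (e : int -> {RV P >-> R})
  (q d : nat) (r mu1 mu2 : R) (phi psi : nat -> R) (y : int -> {RV P >-> R}) :
  iid P (fun n => e n) ->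
  ('E_P[fun w => (e 1%:Z w ^+ 2)%R] < +oo)%E ->
  (0 < q)%N -> (0 < d)%N ->
  let b := fun (n : int) (w : T) =>
    mu1 + e n w + \sum_(1 <= i < q.+1) phi i * e (n - i%:Z) w in
  let a := fun (n : int) (w : T) =>
    mu2 + e n w + \sum_(1 <= i < q.+1) psi i * e (n - i%:Z) w in
  (forall n : int,
     (P [set w | (a n w <= r)%R /\ (b n w <= r)%R] +
      P [set w | (r < a n w)%R /\ (r < b n w)%R])%E != 0%E) ->
  (* y is a strictly stationary solution of the threshold MA equation *)
  strictly_stationary P (fun n => y n) ->
  (forall n : int, {ae P, forall w,
     y n w = if y (n - d%:Z) w <= r then b n w else a n w}) ->
  ('E_P[fun w => (y 0%:Z w ^+ 2)%R] < +oo)%E /\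
  exists C rho : R, 0 < C /\ 0 < rho < 1 /\
    (forall k : nat, (0 < k)%N ->
       (`| covariance P (y 0%:Z) (y k%:Z) | <= (C * rho ^+ k)%:E)%E) /\
    ((0 < variance P (y 0%:Z))%E ->
       exists C' : R, forall k : nat, (0 < k)%N ->
         `| fine (covariance P (y 0%:Z) (y k%:Z)) / fine (variance P (y 0%:Z)) |
           <= C' * rho ^+ k).
Proof.
move=> iide e2 q0 d0 b a Pab _ yae.
pose S := shift_path P e 0.
have SE w : S w = fun i => e i w.
  by apply/funext => i; rewrite /S /shift_path /path_shift add0r.
have ysol : {ae P, forall w, forall k, y k w = if y (k - d%:Z) w <= r
    then lower q mu1 phi (S w) k else upper q mu2 psi (S w) k}.
  by apply: ae_forall_int => n; apply: filterS (yae n) => w; rewrite SE.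
have y2 n : (y n : T -> R) \in Lfun P 2%:E.
  apply: (envelope_bounded_Lfun2 P e q mu1 mu2 phi psi iide e2 _ n) => //.
  exact: (solution_le_envelope P e q d r mu1 mu2 phi psi y ysol).
split; first exact: Lfun2_expectation_sqr.
(* Coupling at time 0 is the disjoint union of the two events in the hypothesis at [n = 0]. *)
have Pc : P (S @^-1` [set x | coupling q r mu1 mu2 phi psi x 0]) != 0%E.
  apply: contra (Pab 0) => /eqP Pc0.
  have mma mu theta n :
      measurable_fun setT (fun w => moving_average q mu theta (S w) n).
    apply: (measurable_path_comp P e (fun x => moving_average q mu theta x n)).
    exact: measurable_moving_average.
  have mab n : measurable_fun setT (a n) /\ measurable_fun setT (b n).
    have -> : a n = fun w => moving_average q mu2 psi (S w) n.
      by apply/funext => w; rewrite SE.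
    have -> : b n = fun w => moving_average q mu1 phi (S w) n.
      by apply/funext => w; rewrite SE.
    by [].
  have msub (f g : T -> R) : measurable_fun setT f -> measurable_fun setT g ->
      measurable [set w | (f w <= g w)].
    move=> mf mg; rewrite -[X in measurable X]setTI.
    have mfg : measurable_fun setT (fun w => f w <= g w).
      by exact: measurable_fun_ler.
    exact: (mfg measurableT [set true]).
  have mA : measurable [set w | (a 0 w <= r)%R /\ (b 0 w <= r)%R].
    by apply: measurableI; apply: msub => //; apply mab.
  have mB : measurable [set w | (r < a 0 w)%R /\ (r < b 0 w)%R].
    rewrite (_ : [set w | _] = ~` [set w | a 0 w <= r] `&` ~` [set w | b 0 w <= r]).
      by apply: measurableI; apply: measurableC; apply: msub => //; apply mab.
    by apply/seteqP; split => w /= [/= h h']; split; move: h h';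
      rewrite ?ltNge => /negP h /negP h' //; exact/negP.
  have PE : (P [set w | (a 0 w <= r)%R /\ (b 0 w <= r)%R] +
      P [set w | (r < a 0 w)%R /\ (r < b 0 w)%R] =
      P (S @^-1` [set x | coupling q r mu1 mu2 phi psi x 0]))%E.
    rewrite -measureU//; last first.
      by apply/seteqP; split => // w /= [[h _] [h' _]]; move: h'; rewrite ltNge h.
    congr (P _); apply/seteqP; split => w /=; rewrite SE /coupling -/(a 0 w) -/(b 0 w).
      by case=> -[]; [move=> -> ->|rewrite !ltNge => /negbTE -> /negbTE ->].
    rewrite !ltNge; case: (a 0 w <= r); case: (b 0 w <= r) => //= _; first by left.
    by right.
  by rewrite PE Pc0.
have [beta [b01 Pbeta]] := exists_decoupling_bound P e q r mu1 mu2 phi psi iide Pc.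
pose L := (q.+1 * d)%N.
have L0 : (0 < L * 2)%N by rewrite /L; lia.
(* In the exponent, [L] accounts for the spacing of the inspected times and 2 for passing from
   second moments to L^2 norms. *)
have [rho [rho01 brho]] := exists_power_ge beta (L * 2) L0 b01.
have /andP[rho0 rho1] := rho01.
pose Ee := ('E_P[fun w => (envelope q mu1 mu2 phi psi (S w) 0 ^+ 2)%R])%E.
have Efin : Ee \is a fin_num.
  rewrite ge0_fin_numE; last by apply: expectation_ge0 => w; exact: sqr_ge0.
  exact: (Lfun2_expectation_sqr P _ (envelope_Lfun2 P e q mu1 mu2 phi psi iide e2 0)).
have Ege0 : 0 <= fine Ee.
  by apply: fine_ge0; apply: expectation_ge0 => w; exact: sqr_ge0.
(* The added 1 makes [kappa] positive and gives [kappa ^+ 2 >= Ee] without a square root. *)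
pose kappa := 1 + fine Ee.
have Ekappa : (Ee <= (kappa ^+ 2)%:E)%E.
  by rewrite -(fineK Efin) lee_fin /kappa; nra.
have kappa0 : 0 < kappa by rewrite /kappa; lra.
(* Dividing by [rho ^+ (L * 2)] compensates for the rounding: [L * (k %/ L).-1 + 2 L >= k], also
   when [k < L]. *)
pose C := (kappa ^+ 2 *+ 2) / rho ^+ (L * 2).
have cov_le k : (`|covariance P (y 0%:Z) (y k%:Z)| <= (C * rho ^+ k)%:E)%E.
  have Pb m : (P (S @^-1` [set x | ~~ coupling q r mu1 mu2 phi psi x m]) <=
      (rho ^+ (L * 2))%:E)%E.
    by apply: le_trans (Pbeta m) _; rewrite lee_fin.
  apply: le_trans (covariance_solution_le P e q d r mu1 mu2 phi psi iide d0 e2 y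
    ysol kappa rho k (ltW kappa0) rho01 Ekappa Pb) _.
  rewrite lee_fin -mulrnAl /C -mulrA ler_wpM2l ?mulrn_wge0 ?sqr_ge0//.
  rewrite mulrC ler_pdivlMr ?exprn_gt0// -exprD ler_wiXn2l ?ltW//.
  have := ltn_ceil k (_ : 0 < L)%N; rewrite -/L; nia.
exists C, rho; split; first by rewrite divr_gt0 ?exprn_gt0// pmulrn_rgt0 ?exprn_gt0.
split=> //; split=> [k _|V0]; first exact: cov_le.
have Vfin : variance P (y 0%:Z) \is a fin_num by exact: variance_fin_num.
have V1 : 0 < fine (variance P (y 0%:Z)) by rewrite -lte_fin fineK.
exists (C / fine (variance P (y 0%:Z))) => k _.
rewrite normrM normfV (gtr0_norm V1) mulrAC ler_pM2r ?invr_gt0//.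
have := cov_le k; case: (covariance _ _ _) => //= *.
Qed.
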